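(* Let $(\mathfrak{S},\mathfrak{C})$ be a KCBS-system, i.e. $\mathfrak{S}=\{(V_i,W_{i\oplus_5 1}):i\in\{1,\ldots,5\}\}$ and $\mathfrak{C}=\{\{V_i,W_i\}:i\in\{1,\ldots,5\}\}$. Then $$\Delta_0(\mathfrak{C})=\frac12\sum_{i=1}^5|\langle V_i\rangle-\langle W_i\rangle|,\qquad \Delta_{\min}(\mathfrak{S},\mathfrak{C})=\frac12\max\Big(2\Delta_0(\mathfrak{C}),\ \mathsf{s}_{odd}\big(\langle V_iW_{i\oplus_5 1}\rangle:i\in\{1,\ldots,5\}\big)-3\Big).$$ Consequently $$\mathsf{CNTX}(\mathfrak{S},\mathfrak{C})=\frac12\max\Big(0,\ \mathsf{s}_{odd}\big(\langle V_iW_{i\oplus_5 1}\rangle:i\in\{1,\ldots,5\}\big)-3-\sum_{i=1}^5|\langle V_i\rangle-\langle W_i\rangle|\Big),$$ and the system has a noncontextual description if and only if $$\mathsf{s}_{odd}\big(\langle V_iW_{i\oplus_5 1}\rangle:i\in\{1,\ldots,5\}\big)\le 3+\sum_{i=1}^5|\langle V_i\rangle-\langle W_i\rangle|.$$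
   Context: $\oplus_5$ denotes cyclic addition on $\{1,\ldots,5\}$ ($i\oplus_5 1=i+1$ for $i<5$, $5\oplus_5 1=1$). All $V_i,W_i$ are $\pm1$-valued random variables. Each pair $(V_i,W_{i\oplus_5 1})$ is jointly distributed, but variables in different pairs are stochastically unrelated (have no given joint distribution); in particular $V_i$ and $W_i$ are never jointly distributed. $\langle\cdot\rangle$ denotes expectation; $\langle V_iW_{i\oplus_5 1}\rangle$ is computed from the given joint distribution of the pair. A coupling of random variables $A,B$ is a jointly distributed pair $(A^*,B^* )$ with $A^*\sim A$, $B^*\sim B$; it is maximal if $\Pr[A^*=B^*]$ is the largest possible over all couplings. A coupling $S$ of $\mathfrak{S}$ is a jointly distributed 10-tuple $(V_1^*,\ldots,V_5^*,W_1^*,\ldots,W_5^* )$ with $(V_i^*,W_{i\oplus_5 1}^* )$ distributed as $(V_i,W_{i\oplus_5 1})$ for each $i$. The system has a (maximally) noncontextual description if some coupling $S$ has each $(V_i^*,W_i^* )$ a maximal coupling of $V_i,W_i$. $\Delta_0(\mathfrak{C})=\frac12\sum_i|\langle V_i\rangle-\langle W_i\rangle|$; $\Delta_{\min}(\mathfrak{S},\mathfrak{C})$ is the infimum over all couplings $S$ of $\sum_{i=1}^5\Pr[V_i^*\ne W_i^*]$; $\mathsf{CNTX}(\mathfrak{S},\mathfrak{C})=\Delta_{\min}(\mathfrak{S},\mathfrak{C})-\Delta_0(\mathfrak{C})$. For reals $a_1,\ldots,a_m$, $\mathsf{s}_{odd}(a_1,\ldots,a_m)$ is the maximum of $\sum_{i=1}^m(\pm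 a_i)$ over all sign choices with an odd number of minus signs. *)

(* Defs.v *)
From HB Require Import structures.
From mathcomp Require Import all_boot all_order all_algebra.
From mathcomp Require Import boolp classical_sets reals.
Set Implicit Arguments. Unset Strict Implicit. Unset Printing Implicit Defensive.
Import Order.TTheory GRing.Theory Num.Theory.
Local Open Scope ring_scope.

(* Conventions: indices 1..5 of the paper are 'I_5 = {0,..,4};
   i (+)_5 1 is [ordS i] (cyclic successor), its inverse is [ord_pred].
   A +-1 valued variable is encoded by a bool: true = +1, false = -1. *)
Definition pm {R : pzRingType} (b : bool) : R := if b then 1 else -1.

Section KCBS.
Variable R : realType.

(* A KCBS system is given by the five joint distributions P i of the pairs
   (V_i, W_{i (+) 1}) : P i (a, b) = Pr[V_i = a, W_{i(+)1} = b]. *)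
Definition is_dist2 (q : bool * bool -> R) :=
  (forall x, 0 <= q x) /\ \sum_x q x = 1.

Definition kcbs_system (P : 'I_5 -> bool * bool -> R) := forall i, is_dist2 (P i).

(* marginal law of V_i and of W_j (W_j belongs to the pair with index j (-) 1) *)
Definition lawV (P : 'I_5 -> bool * bool -> R) (i : 'I_5) (a : bool) : R :=
  \sum_(b : bool) P i (a, b).
Definition lawW (P : 'I_5 -> bool * bool -> R) (j : 'I_5) (b : bool) : R :=
  \sum_(a : bool) P (ord_pred j) (a, b).

Definition EV (P : 'I_5 -> bool * bool -> R) (i : 'I_5) : R :=
  \sum_(x : bool * bool) pm x.1 * P i x.
Definition EW (P : 'I_5 -> bool * bool -> R) (j : 'I_5) : R :=
  \sum_(x : bool * bool) pm x.2 * P (ord_pred j) x.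
Definition EVW (P : 'I_5 -> bool * bool -> R) (i : 'I_5) : R :=
  \sum_(x : bool * bool) pm x.1 * pm x.2 * P i x.

Definition is_coupling (pA pB : bool -> R) (q : bool * bool -> R) :=
  [/\ forall x, 0 <= q x,
      forall a, \sum_(b : bool) q (a, b) = pA a &
      forall b, \sum_(a : bool) q (a, b) = pB b].

Definition prob_eq (q : bool * bool -> R) : R := \sum_(x : (bool * bool)%type | x.1 == x.2) q x.

Definition maximal_coupling (pA pB : bool -> R) (q : bool * bool -> R) :=
  is_coupling pA pB q /\
  forall q', is_coupling pA pB q' -> prob_eq q' <= prob_eq q.

(* A coupling S of the system: a distribution on 10-tuples (V_1..V_5, W_1..W_5) *)
Definition tenT := ({ffun 'I_5 -> bool} * {ffun 'I_5 -> bool})%type.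

Definition pairVW (Q : tenT -> R) (i : 'I_5) (x : bool * bool) : R :=
  \sum_(w : tenT | (w.1 i, w.2 (ordS i)) == x) Q w.
Definition pairVWsame (Q : tenT -> R) (i : 'I_5) (x : bool * bool) : R :=
  \sum_(w : tenT | (w.1 i, w.2 i) == x) Q w.

Definition sys_coupling (P : 'I_5 -> bool * bool -> R) (Q : tenT -> R) :=
  [/\ forall w, 0 <= Q w, \sum_w Q w = 1 &
      forall i x, pairVW Q i x = P i x].

Definition mismatch (Q : tenT -> R) : R :=
  \sum_(i < 5) \sum_(w : tenT | w.1 i != w.2 i) Q w.

Definition Delta0 (P : 'I_5 -> bool * bool -> R) : R :=
  2^-1 * \sum_(i < 5) `|EV P i - EW P i|.

Definition Delta_min (P : 'I_5 -> bool * bool -> R) : R :=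
  inf [set d : R | exists Q, sys_coupling P Q /\ d = mismatch Q].

Definition CNTX (P : 'I_5 -> bool * bool -> R) : R := Delta_min P - Delta0 P.

Definition noncontextual (P : 'I_5 -> bool * bool -> R) :=
  exists Q, sys_coupling P Q /\
    forall i, maximal_coupling (lawV P i) (lawW P i) (pairVWsame Q i).

End KCBS.

(* s_odd(a_1..a_5): maximum over sign vectors s (true = '+') with an odd
   number of minus signs of sum_i s_i a_i.  The seed -sum|a_i| is a lower
   bound of every candidate, so it does not affect the maximum. *)
Definition s_odd {R : realDomainType} (a : 'I_5 -> R) : R :=
  \big[Num.max/(- \sum_(i < 5) `|a i|)]_(s : {ffun 'I_5 -> bool}
                                          | odd #|[set i | ~~ s i]|)
     \sum_(i < 5) pm (s i) * a i.

(* Main.v *)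
(** The ten variables form a cycle V_0, W_1, V_1, W_2, ..., V_4, W_0 whose edges
    are alternately the given pairs (V_i, W_(i+1)) and the connections
    {V_i, W_i}.

    Lower bound: for signs s_i with an odd number of minus signs,
    sum_i s_i V_i W_(i+1) <= 3 + 2 #{i | V_i <> W_i} holds pointwise, since the
    sum can be 5 only if some V_i differs from W_i.

    Upper bound: couple the connections 1, ..., 4 maximally.  By induction along
    the path from V_0 to W_0, every correlation of the two end points that
    satisfies the cycle inequalities and is compatible with their means is
    realised by a coupling of the path: the step picks a chord by a Helly argument
    on intervals, realises the resulting triangle, and glues it to the shorter
    path along the chord.  Taking the largest such correlation of (V_0, W_0) gives
    a coupling whose mismatch equals the lower bound. *)

Require Import Defs.
From HB Require Import structures.
From mathcomp Require Import all_boot all_order all_algebra.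
From mathcomp Require Import boolp classical_sets reals ring lra.
Import Order.TTheory GRing.Theory Num.Theory.
Local Open Scope ring_scope.

Set Implicit Arguments.
Unset Strict Implicit.

(** * Laws of two and three signs in terms of their moments *)

Section PairLaws.
Variable R : realFieldType.
Implicit Types a b c d e p t : R.

(** Walsh expansion on two signs, with means [a], [b] and correlation [c]. *)
Definition pair_law a b c (x y : bool) : R :=
  (1 + pm x * a + pm y * b + pm x * pm y * c) / 4.

Definition pair_ok a b c := forall x y, 0 <= pair_law a b c x y.

(** Means [a], [b], [d] of x, y, z; correlations [c] of xy, [e] of yz, [p] of xz; third moment
    [t]. *)
Definition triple_law a b d c e p t (x y z : bool) : R :=
  (1 + pm x * a + pm y * b + pm z * d + pm x * pm y * c + pm y * pm z * e
   + pm x * pm z * p + pm x * pm y * pm z * t) / 8.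

(* Only the third moment t is free. A positivity constraint bounding t from
   below and one bounding it from above concern atoms that differ in one
   coordinate (their sum is positivity of a pair law) or in all three (their
   sum is a triangle inequality). *)
Lemma triple_law_exists a b d c e p :
  pair_ok a b c -> pair_ok b d e -> pair_ok a d p ->
  (forall x y z, 0 <= 1 + pm x * pm y * c + pm y * pm z * e + pm x * pm z * p) ->
  exists t, forall x y z, 0 <= triple_law a b d c e p t x y z.
Proof.
move=> h1 h2 h3 h4.
(* The atoms with z = xy bound [t] from below by [l x y]. Since [t] equals one of these bounds, each
   upper bound is compared with a single lower bound. *)
pose l x y := - (1 + pm x * a + pm y * b + pm x * pm y * d
  + pm x * pm y * c + pm y * (pm x * pm y) * e + pm x * (pm x * pm y) * p).
pose t := Num.max (Num.max (l true true) (l true false))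
                  (Num.max (l false true) (l false false)).
have u1 x y : l x y <= t by rewrite /t !le_max; case: x y => [] []; rewrite lexx ?orbT.
have [x0 [y0 u0]] : exists x y, t = l x y.
  rewrite /t; case: leP => _; case: leP => _;
    by [exists true, true | exists true, false | exists false, true | exists false, false].
exists t => x y z; have := (h1 x y, h2 y z, h3 x z, h4 x y z, u1 x y).
clearbody t; move: u0; rewrite /pair_law /triple_law /l /pm {h1 h2 h3 h4 l u1}.
by case: x0 y0 x y z => [] [] [] [] [] u0 [[[[? ?] ?] ?]] ?; lra.
Qed.

Lemma triple_lawEl a b d c e p t x y :
  \sum_z triple_law a b d c e p t x y z = pair_law a b c x y.
Proof. by rewrite big_bool /triple_law /pair_law /pm /=; field. Qed.

Lemma triple_lawEr a b d c e p t y z :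
  \sum_x triple_law a b d c e p t x y z = pair_law b d e y z.
Proof. by rewrite big_bool /triple_law /pair_law /pm /=; field. Qed.

Lemma triple_lawEm a b d c e p t x z :
  \sum_y triple_law a b d c e p t x y z = pair_law a d p x z.
Proof. by rewrite big_bool /triple_law /pair_law /pm /=; field. Qed.

(** Quantifying over test functions lets any expectation be rewritten at once; [has_lawP] gives the
    form on atoms. *)
Definition has_law (Om : finType) (mu : Om -> R) (X Y : Om -> bool) a b c :=
  forall f : bool -> bool -> R,
  \sum_w mu w * f (X w) (Y w) = \sum_x \sum_y pair_law a b c x y * f x y.

(** Conditional law of z given x and y; on a null atom any probability would do, here the point mass
    at [true]. *)
Definition law_kernel a b d c e p t (x y z : bool) : R :=
  if pair_law a b c x y == 0 then (z : nat)%:R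
  else triple_law a b d c e p t x y z / pair_law a b c x y.

Lemma law_kernelE a b d c e p t x y z :
  (forall x y z, 0 <= triple_law a b d c e p t x y z) ->
  pair_law a b c x y * law_kernel a b d c e p t x y z =
  triple_law a b d c e p t x y z.
Proof.
move=> h; rewrite /law_kernel; case: eqP => [q0|/eqP q0]; last by rewrite mulrC divfK.
(* Two nonnegative atoms with sum zero both vanish. *)
have := triple_lawEl a b d c e p t x y; rewrite q0 mul0r big_bool /=.
by have [? ?] := (h x y true, h x y false); case: z => ?; lra.
Qed.

Lemma law_kernel_ge0 a b d c e p t x y z :
  pair_ok a b c -> (forall x y z, 0 <= triple_law a b d c e p t x y z) ->
  0 <= law_kernel a b d c e p t x y z.
Proof.
move=> hp h; rewrite /law_kernel; case: eqP => _; first by rewrite ler0n.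
by rewrite divr_ge0.
Qed.

Lemma law_kernel_sum a b d c e p t x y :
  \sum_z law_kernel a b d c e p t x y z = 1.
Proof.
rewrite /law_kernel; case: eqP => [_|/eqP q0]; first by rewrite big_bool /= addr0.
by rewrite -mulr_suml triple_lawEl divff.
Qed.

Definition is_prob (Om : finType) (mu : Om -> R) :=
  (forall w, 0 <= mu w) /\ \sum_w mu w = 1.

(* The new variable is conditionally independent of everything else given
   (X, Y), so all laws already realised on Om are preserved. *)
Lemma extend_by_law (Om : finType) (mu : Om -> R) (X Y : Om -> bool) a b d c e p :
  is_prob mu -> has_law mu X Y a b c ->
  pair_ok a b c -> pair_ok b d e -> pair_ok a d p ->
  (forall x y z, 0 <= 1 + pm x * pm y * c + pm y * pm z * e + pm x * pm z * p) ->
  exists mu' : Om * bool -> R,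
  [/\ is_prob mu',
      forall U V a' b' c', has_law mu U V a' b' c' ->
        has_law mu' (U \o fst) (V \o fst) a' b' c',
      has_law mu' (Y \o fst) snd b d e &
      has_law mu' (X \o fst) snd a d p].
Proof.
move=> [mu0 mu1] hXY h1 h2 h3 h4; have [t ht] := triple_law_exists h1 h2 h3 h4.
pose K := law_kernel a b d c e p t.
pose mu' (w : Om * bool) := mu w.1 * K (X w.1) (Y w.1) w.2.
have E0 (f : Om -> R) : \sum_w mu' w * f w.1 = \sum_w mu w * f w.
  rewrite -(pair_bigA _ (fun w z => mu' (w, z) * f w)) /=; apply: eq_bigr => w _.
  under eq_bigr do rewrite /mu' /= mulrAC.
  by rewrite -mulr_sumr law_kernel_sum mulr1.
have E1 (g : bool -> bool -> bool -> R) : \sum_w mu' w * g (X w.1) (Y w.1) w.2 =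
    \sum_x \sum_y \sum_z triple_law a b d c e p t x y z * g x y z.
  rewrite -(pair_bigA _ (fun w z => mu' (w, z) * g (X w) (Y w) z)) /=.
  under eq_bigr => w _ do
    (under eq_bigr do rewrite /mu' /= -mulrA; rewrite -mulr_sumr).
  rewrite (hXY (fun x y => \sum_z K x y z * g x y z)).
  apply: eq_bigr => x _; apply: eq_bigr => y _; rewrite mulr_sumr.
  by apply: eq_bigr => z _; rewrite mulrA law_kernelE.
exists mu'; split.
- split=> [w|]; first by rewrite mulr_ge0 // law_kernel_ge0.
  by have := E0 (fun=> 1); rewrite -!mulr_suml !mulr1 mu1.
- by move=> U V a' b' c' hUV f; rewrite (E0 (fun w => f (U w) (V w))) hUV.
- move=> f; rewrite (E1 (fun x y z => f y z)) exchange_big; apply: eq_bigr => y _ /=.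
  rewrite exchange_big; apply: eq_bigr => z _ /=.
  by rewrite -mulr_suml triple_lawEr.
- move=> f; rewrite (E1 (fun x y z => f x z)); apply: eq_bigr => x _ /=.
  rewrite exchange_big; apply: eq_bigr => z _ /=.
  by rewrite -mulr_suml triple_lawEm.
Qed.

End PairLaws.

(** * Correlations realisable between the ends of a path *)

Section Paths.
Variable R : realFieldType.
Implicit Types a b c d e p A B : R.

Lemma pair_ok_lin a b c : pair_ok a b c <->
  [/\ 0 <= 1 + a + b + c, 0 <= 1 + a - b - c,
      0 <= 1 - a + b - c & 0 <= 1 - a - b + c].
Proof.
split=> [h|[? ? ? ?]]; last by case; case; rewrite /pair_law /pm; lra.
have := (h true true, h true false, h false true, h false false).
by rewrite /pair_law /pm => -[[[? ?] ?] ?]; split; lra.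
Qed.

(** With s = yz and t = xz one has xy = st, so the triangle inequalities are the positivity of a
    pair law with means [e], [p] and correlation [c]. *)
Lemma pair_ok_triangle c e p : pair_ok e p c -> forall x y z : bool,
  0 <= 1 + pm x * pm y * c + pm y * pm z * e + pm x * pm z * p.
Proof.
by move=> /pair_ok_lin[? ? ? ?] [] [] []; rewrite /pm; lra.
Qed.

(* [A <= c <= - B] are the cycle inequalities that a chord of correlation [c]
   closing a path must satisfy; the conditions below make them compatible with
   [pair_ok a b c], where [a] and [b] are the means at the ends of the path. *)
Definition bounds_ok a b A B :=
  [/\ A + B <= 0, A + (a - b) <= 1, A - (a - b) <= 1,
      B + (a + b) <= 1 & B - (a + b) <= 1].

Lemma normr_cases (x : R) : exists2 y, `|x| = y & [/\ x <= y, - x <= y & y = x \/ y = - x].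
Proof.
exists `|x|; rewrite // ler_norm -normrN ler_norm; split=> //.
by rewrite normrN; case: ger0P => _; [left | right].
Qed.

(** Three intervals constrain [c], and by Helly on the line they need only meet pairwise.
    [bounds_ok] and the last four hypotheses handle [A, -B] against the other two; the two [pair_ok]
    hypotheses make those two meet. *)
Lemma chord_exists a b d e p A B :
  pair_ok b d e -> pair_ok a d p -> bounds_ok a b A B ->
  A + (e - p) <= 1 -> A - (e - p) <= 1 ->
  B + (e + p) <= 1 -> B - (e + p) <= 1 ->
  exists c, [/\ pair_ok a b c, pair_ok e p c, A <= c & c <= - B].
Proof.
move=> /pair_ok_lin[? ? ? ?] /pair_ok_lin[? ? ? ?] [? ? ? ? ?] ? ? ? ?.
(* The Helly point: the largest of all lower ends. *)
pose c := Num.max A (Num.max (Num.max (a + b - 1) (- (a + b) - 1))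
                             (Num.max (e + p - 1) (- (e + p) - 1))).
have lec x : c <= x = [&& A <= x, a + b - 1 <= x & - (a + b) - 1 <= x]
    && [&& A <= x, e + p - 1 <= x & - (e + p) - 1 <= x].
  by rewrite /c !ge_max; case: (A <= x).
have [l1 l2 l3 l4 l5] : [/\ A <= c, a + b - 1 <= c, - (a + b) - 1 <= c,
    e + p - 1 <= c & - (e + p) - 1 <= c].
  by rewrite /c !le_max !lexx !orbT.
have [u1 u2 u3 u4 u5] : [/\ c <= - B, c <= 1 - (a - b), c <= 1 + (a - b),
    c <= 1 - (e - p) & c <= 1 + (e - p)].
  rewrite !lec; clear lec l1 l2 l3 l4 l5 c.
  by split; apply/andP; split; apply/and3P; split; lra.
by exists c; split=> //; apply/pair_ok_lin; clear -l2 l3 l4 l5 u2 u3 u4 u5; split; lra.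
Qed.

(** The last four hypotheses of [chord_exists], solved for [p], give the even step of [bounds]. *)
Lemma chord_exists_free a b d e p A B :
  pair_ok b d e -> pair_ok a d p -> bounds_ok a b A B ->
  Num.max (A + e - 1) (B - e - 1) <= p ->
  p <= - Num.max (B + e - 1) (A - e - 1) ->
  exists c, [/\ pair_ok a b c, pair_ok e p c, A <= c & c <= - B].
Proof.
move=> e_ok p_ok bok; rewrite lerNr !ge_max => /andP[h1 h2] /andP[h3 h4].
by apply: (chord_exists e_ok p_ok bok); clear -h1 h2 h3 h4; lra.
Qed.

(** At a maximal connection, the two conditions where [e] has a minus sign follow from the means by
    the triangle inequality. *)
Lemma chord_exists_maximal a b d p A B (e := 1 - `|b - d|) :
  pair_ok b d e -> pair_ok a d p -> bounds_ok a b A B ->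
  A - `|b - d| <= p -> p <= - (B - `|b - d|) ->
  exists c, [/\ pair_ok a b c, pair_ok e p c, A <= c & c <= - B].
Proof.
move=> e_ok p_ok bok hA hB; apply: (chord_exists e_ok p_ok bok).
all: move: hA hB p_ok bok; rewrite {e_ok}/e.
all: have [y -> [_ _ y_eq]] := normr_cases (b - d).
all: move=> hA hB /pair_ok_lin[? ? ? ?] [_ ? ? ? ?].
1,3: by clear -hA hB; lra.
all: by case: y_eq => ?; lra.
Qed.

Variables m e : nat -> R.

(** Eliminating the previous chord gives the interval [A, -B] for the chord from 0 to n. A collects
    signed sums with an even number of minus signs, B those with an odd number; a maximal connection
    enters with a plus sign only. The start (1, -1) forces a variable to have correlation 1 with
    itself. *)
Fixpoint bounds n : R * R :=
  if n is n'.+1 then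
    let: (A, B) := bounds n' in
    if odd n' then (A - `|m n' - m n|, B - `|m n' - m n|)
    else (Num.max (A + e n' - 1) (B - e n' - 1),
          Num.max (B + e n' - 1) (A - e n' - 1))
  else (1, - 1).

Hypothesis e_ok : forall n, pair_ok (m n) (m n.+1) (e n).
Hypothesis e_odd : forall n, odd n -> e n = 1 - `|m n - m n.+1|.

Lemma bounds_okP n : bounds_ok (m 0) (m n) (bounds n).1 (bounds n).2.
Proof.
have mb k : - 1 <= m k /\ m k <= 1.
  by case/pair_ok_lin: (e_ok k) => *; split; lra.
elim: n => [|n] /=; first by have [? ?] := mb 0; split; lra.
case: (bounds n) => A B /= [? ? ? ? ?].
case/pair_ok_lin: (e_ok n) => ? ? ? ?.
case: ifP => _ /=.
  by have [y -> [? ? ?]] := normr_cases (m n - m n.+1); split; lra.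
by case: leP => _; case: leP => _; split; lra.
Qed.

Lemma path_exists n c :
  pair_ok (m 0) (m n) c -> (bounds n).1 <= c -> c <= - (bounds n).2 ->
  exists (Om : finType) (mu : Om -> R) (x : nat -> Om -> bool),
  [/\ is_prob mu,
      forall i, (i < n)%N -> has_law mu (x i) (x i.+1) (m i) (m i.+1) (e i) &
      has_law mu (x 0) (x n) (m 0) (m n) c].
Proof.
elim: n c => [|n IHn] c.
  move=> c_ok /= c1; rewrite opprK => c2.
  have -> : c = 1 by lra.
  exists bool, (fun b : bool => (1 + pm b * m 0) / 2), (fun _ => id).
  case/pair_ok_lin: (e_ok 0) => ? ? ? ?; split=> //.
    split; first by case; rewrite /pm; lra.
    by rewrite big_bool /pm /=; lra.
  by move=> f; rewrite !big_bool /pair_law /pm /=; field.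
move=> c_ok hA hB; have := bounds_okP n; move: hA hB => /=.
case Ebn: (bounds n) IHn => [A B] IHn hA hB bok.
have [c' [c'_ok c'_tri hA' hB']] : exists c',
    [/\ pair_ok (m 0) (m n) c', pair_ok (e n) c c', A <= c' & c' <= - B].
  case: ifP hA hB => [/e_odd En|_] hA hB; last exact: chord_exists_free hA hB.
  by rewrite En; apply: chord_exists_maximal hA hB => //; rewrite -En.
have [Om [mu [x [mu_prob xi x0n]]]] := IHn c' c'_ok hA' hB'.
have [mu' [mu'_prob mono lxz lx0]] :=
  extend_by_law mu_prob x0n c'_ok (e_ok n) c_ok (pair_ok_triangle c'_tri).
exists (Om * bool)%type, mu', (fun i w => if (i <= n)%N then x i w.1 else w.2).
split=> //; last by rewrite /= ltnn.
move=> i i_le; have /predU1P[->|lt_in] : (i == n) || (i < n)%N by rewrite -leq_eqVlt.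
  by rewrite /= leqnn ltnn.
by rewrite /= ltnW // lt_in; apply: mono; apply: xi.
Qed.

End Paths.

(** * Signed sums around the cycle *)

Lemma sum_bool2 (R : nmodType) (F : bool * bool -> R) :
  \sum_x F x = F (true, true) + F (true, false) + F (false, true) + F (false, false).
Proof.
by rewrite (eq_bigr (fun x => F (x.1, x.2))) => [|[]//];
   rewrite -(pair_bigA _ (fun x y => F (x, y))) /= !big_bool /= !addrA.
Qed.

Lemma sum_ord5 (R : nmodType) (F : 'I_5 -> R) :
  \sum_i F i = F (inord 0) + F (inord 1) + F (inord 2) + F (inord 3) + F (inord 4).
Proof.
rewrite !big_ord_recl big_ord0 addr0 !addrA.
by do !congr (_ + _); congr F; apply/val_inj; rewrite /= inordK.
Qed.

Section Odd.
Variable R : realFieldType.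

Lemma le_s_odd (a : 'I_5 -> R) (s : {ffun 'I_5 -> bool}) :
  odd #|[set i | ~~ s i]| -> \sum_(i < 5) pm (s i) * a i <= s_odd a.
Proof. by move=> s_odd; apply: le_bigmax_cond. Qed.

Lemma card_minus (s : {ffun 'I_5 -> bool}) :
  #|[set i | ~~ s i]| = (\sum_(i < 5) ~~ s i)%N.
Proof. by rewrite -sum1dep_card big_mkcond; apply: eq_bigr => i _; case: (s i). Qed.

Lemma le_s_odd5 (a : 'I_5 -> R) (s0 s1 s2 s3 s4 : bool) :
  ~~ s0 (+) ~~ s1 (+) ~~ s2 (+) ~~ s3 (+) ~~ s4 ->
  pm s0 * a (inord 0) + pm s1 * a (inord 1) + pm s2 * a (inord 2)
  + pm s3 * a (inord 3) + pm s4 * a (inord 4) <= s_odd a.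
Proof.
move=> hs; pose s := [ffun i : 'I_5 => nth true [:: s0; s1; s2; s3; s4] i].
have := @le_s_odd a s; rewrite sum_ord5 !ffunE !inordK //=; apply.
rewrite card_minus !big_ord_recl big_ord0 !ffunE /= addn0 !oddD !oddb.
by rewrite !addbA.
Qed.

(* The parities of the sign pattern and of the disagreements V_i <> W_(i+1) and
   V_i <> W_i add up to an odd number, because each V_i and W_i occurs twice. *)
Lemma odd_cycle_le (s v w : {ffun 'I_5 -> bool}) :
  odd #|[set i | ~~ s i]| ->
  \sum_(i < 5) pm (s i) * (pm (v i) * pm (w (ordS i))) <=
  3 + 2 * \sum_(i < 5) (v i != w i)%:R :> R.
Proof.
rewrite card_minus => hs.
(* [t i] marks a negative term: the i-th signed product is 1 - 2 [t i]. *)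
pose t i := ~~ s i (+) (v i (+) w (ordS i)).
have : odd (\sum_(i < 5) (t i + (v i != w i)))%N.
  have oddE F : odd (\sum_(i < 5) F i)%N = \big[addb/false]_(i < 5) odd (F i).
    exact: (big_morph odd oddD).
  have xorS : \big[addb/false]_(i < 5) w (ordS i) = \big[addb/false]_(i < 5) w i.
    by rewrite [RHS](reindex (@ordS 5)) //; apply/onW_bij/ordS_bij.
  move: hs; rewrite !oddE.
  rewrite [X in _ -> is_true X](eq_bigr (fun i => odd (~~ s i) (+) (w (ordS i) (+) w i))).
    by rewrite !big_split /= xorS addbb addbF.
  by move=> i _; rewrite /t oddD !oddb; case: (s i) (v i) (w i) (w (ordS i)) => [] [] [] [].
(* An odd count is at least 1, which bounds the sum of [t] from below. *)
move/odd_gt0; rewrite -(ler1n R) natr_sum.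
under eq_bigr do rewrite natrD.
rewrite big_split /= => h.
rewrite (eq_bigr (fun i => 1 - 2 * (t i)%:R)); last first.
  by move=> i _; rewrite /t /pm; case: (s i) (v i) (w (ordS i)) => [] [] []; rewrite /=; ring.
rewrite big_split /= sumrN -mulr_sumr sumr_const card_ord; lra.
Qed.
End Odd.

(** * Probabilities of events and image measures *)

Section HasLaw.
Variable R : realFieldType.

Lemma sum_eq_natr (Om : finType) (mu : Om -> R) (p : pred Om) :
  \sum_(w | p w) mu w = \sum_w mu w * (p w)%:R.
Proof.
by rewrite big_mkcond; apply: eq_bigr => w _; case: ifP; rewrite ?mulr1 ?mulr0.
Qed.

Lemma has_lawP (Om : finType) (mu : Om -> R) (X Y : Om -> bool) (a b c : R) :
  has_law mu X Y a b c <->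
  forall x, \sum_(w | (X w, Y w) == x) mu w = pair_law a b c x.1 x.2.
Proof.
split=> [h [x y]|h f].
  rewrite sum_eq_natr (h (fun x' y' => ((x', y') == (x, y))%:R)) !big_bool /=.
  by case: x y => [] []; rewrite /= !(mulr1, mulr0, addr0, add0r).
rewrite (partition_big (fun w => (X w, Y w)) predT) //= pair_bigA /=.
apply: eq_bigr => x _; rewrite -h mulr_suml.
by apply: eq_bigr => w /eqP <-.
Qed.

Lemma has_law_neq (Om : finType) (mu : Om -> R) (X Y : Om -> bool) (a b c : R) :
  has_law mu X Y a b c -> \sum_(w | X w != Y w) mu w = (1 - c) / 2.
Proof.
move=> h; rewrite sum_eq_natr (h (fun x y => (x != y)%:R)) !big_bool /=.
by rewrite /pair_law /pm /=; field.
Qed.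

Definition pushforward (Om Om' : finType) (mu : Om -> R) (phi : Om -> Om') w' : R :=
  \sum_(w | phi w == w') mu w.

Lemma pushforward_sum (Om Om' : finType) (mu : Om -> R) (phi : Om -> Om') (p : pred Om') :
  \sum_(w' | p w') pushforward mu phi w' = \sum_(w | p (phi w)) mu w.
Proof.
rewrite [RHS](partition_big phi p) //=; apply: eq_bigr => w' pw'.
by apply: eq_bigl => w; case: eqP => [->|]; rewrite ?pw' ?andbF.
Qed.

Lemma pushforward_prob (Om Om' : finType) (mu : Om -> R) (phi : Om -> Om') :
  is_prob mu -> is_prob (pushforward mu phi).
Proof.
move=> [mu0 mu1]; split=> [w'|]; first exact: sumr_ge0.
by rewrite (pushforward_sum mu phi predT).
Qed.

End HasLaw.

(** * Lower bounds valid for every coupling of the system *)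

Section System.
Variables (R : realType) (P : 'I_5 -> bool * bool -> R).
Hypothesis P_sys : kcbs_system P.

Lemma systemE i x : P i x = pair_law (EV P i) (EW P (ordS i)) (EVW P i) x.1 x.2.
Proof.
have [_] := P_sys i; rewrite /pair_law /EV /EW /EVW ordSK !sum_bool2 /pm /=.
by case: x => [] [] [] /= ?; lra.
Qed.

Lemma system_ok i : pair_ok (EV P i) (EW P (ordS i)) (EVW P i).
Proof.
by move=> x y; rewrite -(systemE i (x, y)); case: (P_sys i).
Qed.

Lemma lawVE i a : lawV P i a = (1 + pm a * EV P i) / 2.
Proof. by rewrite /lawV big_bool /= !systemE /pair_law /pm; case: a => /=; lra. Qed.

Lemma lawWE j b : lawW P j b = (1 + pm b * EW P j) / 2.
Proof.
by rewrite /lawW big_bool /= !systemE ord_predK /pair_law /pm; case: b => /=; lra.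
Qed.

Definition gap i : R := `|EV P i - EW P i|.

Lemma mean_bounds i : [/\ -1 <= EV P i, EV P i <= 1, -1 <= EW P i & EW P i <= 1].
Proof.
have /pair_ok_lin[? ? ? ?] := system_ok i.
have := system_ok (ord_pred i); rewrite ord_predK => /pair_ok_lin[? ? ? ?].
by split; lra.
Qed.

Lemma maximal_pair_ok (a b : R) : -1 <= a -> a <= 1 -> -1 <= b -> b <= 1 ->
  pair_ok a b (1 - `|a - b|).
Proof.
move=> ? ? ? ?; have [y -> [? ? y_eq]] := normr_cases (a - b).
by apply/pair_ok_lin; split; case: y_eq => ?; lra.
Qed.

Lemma prob_eqE (q : bool * bool -> R) : prob_eq q = q (true, true) + q (false, false).
Proof. by rewrite /prob_eq big_mkcond sum_bool2 /= !addr0. Qed.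

(** Agreement is at most the sum of the pointwise minima of the two marginal laws. *)
Lemma prob_eq_le i q : is_coupling (lawV P i) (lawW P i) q -> prob_eq q <= 1 - gap i / 2.
Proof.
case=> q0 qV qW; rewrite prob_eqE /gap.
have := (q0 (true, true), q0 (true, false), q0 (false, true), q0 (false, false)).
have := (qV true, qV false, qW true, qW false).
rewrite !big_bool !lawVE !lawWE /pm /=.
by move=> [[[? ?] ?] ?] [[[? ?] ?] ?]; case: ger0P => _; lra.
Qed.

Lemma maximal_couplingE i q :
  maximal_coupling (lawV P i) (lawW P i) q <->
  is_coupling (lawV P i) (lawW P i) q /\ prob_eq q = 1 - gap i / 2.
Proof.
split=> [[qc qmax]|[qc q_eq]]; split=> //; last first.
  by move=> q' /prob_eq_le; rewrite q_eq.
apply/le_anti; rewrite prob_eq_le //=.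
(* The pair law of largest correlation attains the bound. *)
pose q' x := pair_law (EV P i) (EW P i) (1 - gap i) x.1 x.2.
have -> : 1 - gap i / 2 = prob_eq q' by rewrite prob_eqE /q' /pair_law /pm /=; lra.
apply: qmax; split=> [x|a|b].
- by have [? ? ? ?] := mean_bounds i; apply: maximal_pair_ok.
- by rewrite lawVE big_bool /q' /pair_law /pm /=; case: a => /=; lra.
- by rewrite lawWE big_bool /q' /pair_law /pm /=; case: b => /=; lra.
Qed.

Definition mismatch_at (Q : tenT -> R) i := \sum_(w : tenT | w.1 i != w.2 i) Q w.

Section Coupling.
Variable Q : tenT -> R.
Hypothesis Q_coup : sys_coupling P Q.

Lemma coupling_law i : has_law Q (fun w : tenT => w.1 i) (fun w => w.2 (ordS i))
  (EV P i) (EW P (ordS i)) (EVW P i).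
Proof. by case: Q_coup => _ _ h; apply/has_lawP => x; rewrite -systemE -h. Qed.

Lemma coupling_lawV i a : \sum_(w : tenT | w.1 i == a) Q w = lawV P i a.
Proof.
rewrite sum_eq_natr (coupling_law i (fun x _ => (x == a)%:R)) lawVE !big_bool.
by rewrite /pair_law /pm /=; case: a => /=; lra.
Qed.

Lemma coupling_lawW i b : \sum_(w : tenT | w.2 i == b) Q w = lawW P i b.
Proof.
rewrite sum_eq_natr lawWE.
have := coupling_law (ord_pred i) (fun _ y => (y == b)%:R).
rewrite ord_predK => ->; rewrite !big_bool.
by rewrite /pair_law /pm /=; case: b => /=; lra.
Qed.

Lemma pairVWsame_coupling i : is_coupling (lawV P i) (lawW P i) (pairVWsame Q i).
Proof.
case: (Q_coup) => Q0 _ _; split=> [x|a|b]; first exact: sumr_ge0.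
  by rewrite -coupling_lawV (partition_big (fun w : tenT => w.2 i) predT).
rewrite -coupling_lawW (partition_big (fun w : tenT => w.1 i) predT) //=.
by apply: eq_bigr => x _; apply: eq_bigl => w; rewrite xpair_eqE andbC.
Qed.

Lemma prob_eq_pairVWsame i : prob_eq (pairVWsame Q i) = 1 - mismatch_at Q i.
Proof.
case: (Q_coup) => _ <- _; rewrite /mismatch_at.
rewrite [X in X - _](bigID (fun w : tenT => w.1 i == w.2 i)) /=.
rewrite addrK (partition_big (fun w : tenT => (w.1 i, w.2 i)) (fun x => x.1 == x.2)) //=.
apply: eq_bigr => -[a b] /= /eqP<-; apply: eq_bigl => w.
by rewrite xpair_eqE; case: (w.1 i) (w.2 i) a => [] [] [].
Qed.

Lemma mismatch_at_ge i : gap i / 2 <= mismatch_at Q i.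
Proof.
by have := prob_eq_le (pairVWsame_coupling i); rewrite prob_eq_pairVWsame; lra.
Qed.

Lemma mismatch_ge_gap : 2^-1 * \sum_i gap i <= mismatch Q.
Proof. by rewrite mulr_sumr; apply: ler_sum => i _; rewrite mulrC mismatch_at_ge. Qed.

Lemma mismatch_ge_s_odd : s_odd (EVW P) <= 3 + 2 * mismatch Q.
Proof.
have [Q0 Q1 _] := Q_coup.
apply: bigmax_le => [|s s_odd].
  have : 0 <= mismatch Q by apply: sumr_ge0 => i _; apply: sumr_ge0.
  have : 0 <= \sum_i `|EVW P i| by apply: sumr_ge0.
  lra.
(* Both sides become expectations under [Q], so the pointwise cycle inequality can be integrated. *)
have -> : \sum_i pm (s i) * EVW P i =
    \sum_w Q w * \sum_i pm (s i) * (pm (w.1 i) * pm (w.2 (ordS i))).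
  under [RHS]eq_bigr do rewrite mulr_sumr.
  rewrite exchange_big; apply: eq_bigr => i _ /=.
  under eq_bigr do rewrite mulrCA.
  rewrite -mulr_sumr (coupling_law i (fun x y => pm x * pm y)) !big_bool.
  by congr (_ * _); rewrite /pair_law /pm /=; lra.
have -> : 3 + 2 * mismatch Q = \sum_w Q w * (3 + 2 * \sum_i (w.1 i != w.2 i)%:R).
  under [RHS]eq_bigr do rewrite mulrDr mulrCA mulr_sumr.
  rewrite big_split /= -mulr_suml Q1 mul1r -mulr_sumr exchange_big.
  by congr (_ + _ * _); apply: eq_bigr => i _; rewrite sum_eq_natr.
by apply: ler_sum => w _; rewrite ler_wpM2l // odd_cycle_le.
Qed.

End Coupling.
End System.

(** * The path through the ten variables and an optimal coupling *)

Lemma bounds9_le (R : realFieldType) (m e : nat -> R) (T : R) :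
  - 1 <= e 0 -> e 0 <= 1 ->
  (forall s0 s1 s2 s3 s4 : bool,
     ~~ s0 (+) ~~ s1 (+) ~~ s2 (+) ~~ s3 (+) ~~ s4 ->
     pm s0 * e 0 + pm s1 * e 2 + pm s2 * e 4 + pm s3 * e 6 + pm s4 * e 8 <= T) ->
  (bounds m e 9).2 <=
    T - 4 - (`|m 1 - m 2| + `|m 3 - m 4| + `|m 5 - m 6| + `|m 7 - m 8|).
Proof.
move=> e0_ge e0_le hT; rewrite /=.
(* The first edge costs nothing; edges 2, 4, 6, 8 each subtract 1, whence the constant 4. *)
have -> : Num.max (1 + e 0 - 1) (- 1 - e 0 - 1) = e 0.
  by rewrite max_l; lra.
have -> : Num.max (- 1 + e 0 - 1) (1 - e 0 - 1) = - e 0.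
  by rewrite max_r; lra.
rewrite !addr_maxl !ge_max {e0_ge e0_le}.
(* Odd parity determines the fifth sign from the other four. *)
have h s0 s1 s2 s3 : pm s0 * e 0 + pm s1 * e 2 + pm s2 * e 4 + pm s3 * e 6
    + pm (s0 (+) s1 (+) s2 (+) s3) * e 8 <= T.
  by apply: hT; case: s0 s1 s2 s3 => [] [] [] [].
have := (h true true true true, h true true true false,
  h true true false true, h true true false false,
  h true false true true, h true false true false,
  h true false false true, h true false false false).
have := (h false true true true, h false true true false,
  h false true false true, h false true false false,
  h false false true true, h false false true false,
  h false false false true, h false false false false).
rewrite /pm /= {hT h}.
move: (e 0) (e 2) (e 4) (e 6) (e 8) => e0 e2 e4 e6 e8.
set d1 : R := `|m 1 - m 2|; set d2 : R := `|m 3 - m 4|.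
set d3 : R := `|m 5 - m 6|; set d4 : R := `|m 7 - m 8|.
clearbody d1 d2 d3 d4; clear m e.
move=> [[[[[[[? ?] ?] ?] ?] ?] ?] ?] [[[[[[[? ?] ?] ?] ?] ?] ?] ?].
by do !(apply/andP; split); lra.
Qed.

Section Construction.
Variables (R : realType) (P : 'I_5 -> bool * bool -> R).
Hypothesis P_sys : kcbs_system P.

(* The path V_0, W_1, V_1, W_2, ..., V_4, W_0. *)
Definition path_mean n : R :=
  if odd n then EW P (ordS (inord n./2)) else EV P (inord n./2).

Definition path_corr n : R :=
  if odd n then 1 - `|path_mean n - path_mean n.+1| else EVW P (inord n./2).

Lemma path_mean_bounds n : -1 <= path_mean n /\ path_mean n <= 1.
Proof.
rewrite /path_mean; case: ifP => _; first by case: (mean_bounds P_sys (ordS (inord n./2))).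
by case: (mean_bounds P_sys (inord n./2)).
Qed.

Lemma path_ok n : pair_ok (path_mean n) (path_mean n.+1) (path_corr n).
Proof.
rewrite /path_corr; case: ifP => [_|n_even].
  have [? ?] := path_mean_bounds n; have [? ?] := path_mean_bounds n.+1.
  exact: maximal_pair_ok.
by rewrite /path_mean /= n_even uphalf_half n_even; apply: system_ok.
Qed.

Lemma ordS_inord k : (k < 5)%N -> ordS (inord k) = inord (k.+1 %% 5) :> 'I_5.
Proof. by move=> k5; apply/val_inj; rewrite /= !inordK // ltn_mod. Qed.

Lemma path_bounds9 : (bounds path_mean path_corr 9).2 <=
  s_odd (EVW P) - 4 - (gap P (inord 1) + gap P (inord 2) + gap P (inord 3) + gap P (inord 4)).
Proof.
apply: le_trans (bounds9_le (T := s_odd (EVW P)) _ _ _ _) _.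
- by case/pair_ok_lin: (path_ok 0) => *; lra.
- by case/pair_ok_lin: (path_ok 0) => *; lra.
- exact: le_s_odd5.
by rewrite /path_mean /= !ordS_inord // /gap; do 4 rewrite [`|EW P _ - _|]distrC.
Qed.
End Construction.

(** [c] is the smaller of two upper ends; [bounds_ok] makes the intervals meet, so [c] stays above
    both lower ends. *)
Lemma largest_chord (R : realFieldType) (a b A B : R) (c := Num.min (1 - `|a - b|) (- B)) :
  -1 <= a -> a <= 1 -> -1 <= b -> b <= 1 -> bounds_ok a b A B ->
  [/\ pair_ok a b c, A <= c & c <= - B].
Proof.
move=> ? ? ? ? [? ? ? ? ?]; have [y Ey [? ? hy]] := normr_cases (a - b).
have [c1 c2] : c <= 1 - y /\ c <= - B by rewrite /c Ey !ge_min !lexx orbT.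
have hc : c = 1 - y \/ c = - B by rewrite /c Ey; case: leP => _; [left | right].
clearbody c; clear Ey.
split=> //; last by case: hc => ->; case: hy => ?; lra.
by apply/pair_ok_lin; split; case: hc => ?; case: hy => ?; lra.
Qed.

Section Optimum.
Variables (R : realType) (P : 'I_5 -> bool * bool -> R).
Hypothesis P_sys : kcbs_system P.

(* All connections but {V_0, W_0} are coupled maximally; the last one receives
   the largest agreement allowed by the cycle inequalities. *)
Lemma coupling_exists : exists2 Q, sys_coupling P Q &
  mismatch Q <= 2^-1 * Num.max (\sum_i gap P i) (s_odd (EVW P) - 3).
Proof.
have corr_odd n : odd n -> path_corr P n = 1 - `|path_mean P n - path_mean P n.+1|.
  by rewrite /path_corr => ->.
have B9 := path_bounds9 P_sys.
have := bounds_okP (path_ok P_sys) 9.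
have path_ex := @path_exists _ _ _ (path_ok P_sys) corr_odd 9.
move: (bounds _ _ 9) B9 path_ex => [A B] /= B9 path_ex.
have m0 : path_mean P 0 = EV P (inord 0) by [].
have m9 : path_mean P 9 = EW P (inord 0) by rewrite /path_mean /= ordS_inord.
rewrite m0 m9 in path_ex * => bok.
pose c := Num.min (1 - gap P (inord 0)) (- B).
have [c_ok Ac cB] : [/\ pair_ok (EV P (inord 0)) (EW P (inord 0)) c, A <= c & c <= - B].
  have [? ? ? ?] := mean_bounds P_sys (inord 0).
  exact: (largest_chord _ _ _ _ bok).
have [Om [mu [x [mu_prob x_law x09]]]] := path_ex c c_ok Ac cB.
(* V_i sits at position 2i and W_(i+1) at 2i+1, so W_0 comes last, at position 9. *)
pose phi w : tenT := ([ffun i : 'I_5 => x i.*2 w],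
                      [ffun j : 'I_5 => x (ord_pred j).*2.+1 w]).
have [Q0 Q1] := pushforward_prob phi mu_prob.
exists (pushforward mu phi).
  split=> // i y; rewrite /pairVW pushforward_sum systemE //.
  have lt_i : (i.*2 < 9)%N by rewrite ltnS (leq_double i 4) -ltnS.
  have := x_law _ lt_i; rewrite /path_corr /path_mean /= odd_double /=.
  rewrite uphalf_double doubleK inord_val => /has_lawP <-.
  have predS : ((ordS i + 5).-1 %% 5)%N = i := congr1 val (ordSK i).
  by apply: eq_bigl => w; rewrite !ffunE predS.
have mis k : (0 < k < 5)%N -> mismatch_at (pushforward mu phi) (inord k) = gap P (inord k) / 2.
  case: k => [//|k] /= lt_k.
  have lt_i : (k.*2.+1 < 9)%N by rewrite ltnS (ltn_double k 4).
  have := x_law _ lt_i; rewrite corr_odd /path_mean /= ?odd_double //= uphalf_double doubleK.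
  rewrite ordS_inord ?modn_small ?(ltnW lt_k) // => /has_law_neq h.
  rewrite /mismatch_at pushforward_sum /gap distrC; move: h.
  rewrite opprB addrCA subrr addr0 => <-; apply: eq_bigl => w.
  rewrite /phi /= !ffunE inordK // eq_sym; congr (x _ _ != _).
  by rewrite addSn /= modnDr modn_small // ltnW.
have mis0 : mismatch_at (pushforward mu phi) (inord 0) = (1 - c) / 2.
  rewrite /mismatch_at pushforward_sum -(has_law_neq x09); apply: eq_bigl => w.
  by rewrite /phi /= !ffunE inordK.
rewrite -[mismatch _]/(\sum_(i < 5) mismatch_at _ i) sum_ord5 mis0 !mis //.
set sum_gap := \sum_(i < 5) gap P i.
have [le1 le2] : sum_gap <= Num.max sum_gap (s_odd (EVW P) - 3) /\
    s_odd (EVW P) - 3 <= Num.max sum_gap (s_odd (EVW P) - 3).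
  by rewrite !le_max !lexx orbT.
(* In the first case the mismatch is half the sum of the gaps; in the second [B9] bounds it by half
   of [s_odd] - 3. *)
have : c = 1 - gap P (inord 0) \/ c = - B by rewrite /c; case: leP => _; [left | right].
by move: le1 le2; rewrite /sum_gap {1}sum_ord5 => ? ? [] ->; lra.
Qed.

End Optimum.
Unset Implicit Arguments.

(** * Values of the infimum and the noncontextuality criterion *)

Theorem theorem31 (R : realType) (P : 'I_5 -> bool * bool -> R)
  (hP : kcbs_system P) :
  let d := \sum_(i < 5) `|EV P i - EW P i| in
  let so := s_odd (EVW P) in
  [/\ Delta0 P = 2^-1 * d,
      Delta_min P = 2^-1 * Num.max (2 * Delta0 P) (so - 3),
      CNTX P = 2^-1 * Num.max 0 (so - 3 - d) &
      (noncontextual P <-> so <= 3 + d)].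
Proof.
move=> d so.
have mism_ge Q : sys_coupling P Q -> 2^-1 * Num.max d (so - 3) <= mismatch Q.
  move=> hQ; have h1 : 2^-1 * d <= mismatch Q := mismatch_ge_gap hP hQ.
  have h2 : so <= 3 + 2 * mismatch Q := mismatch_ge_s_odd hP hQ.
  have : Num.max d (so - 3) <= 2 * mismatch Q by rewrite ge_max; apply/andP; split; lra.
  by lra.
have [Q Q_coup Q_le] := coupling_exists hP; rewrite -[\sum_i _]/d -/so in Q_le.
have D0 : 2 * Delta0 P = d by rewrite /Delta0 -/d; lra.
have Dmin : Delta_min P = 2^-1 * Num.max d (so - 3).
  apply/le_anti/andP; split.
    apply: le_trans Q_le; apply: ge_inf; last by exists Q.
    by exists (2^-1 * Num.max d (so - 3)) => _ [Q' [hQ' ->]]; apply: mism_ge.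
  apply: lb_le_inf; first by exists (mismatch Q), Q.
  by move=> _ [Q' [hQ' ->]]; apply: mism_ge.
split; rewrite ?D0 //.
  by rewrite /CNTX Dmin /Delta0 -/d; case: leP => ?; case: leP => ?; lra.
split=> [[Q' [hQ' Q'_max]]|so_le].
  have := mismatch_ge_s_odd hP hQ'; suff -> : mismatch Q' = 2^-1 * d by rewrite -/so; lra.
  rewrite /mismatch /d mulr_sumr; apply: eq_bigr => i _.
  have [_] := (maximal_couplingE hP _ _).1 (Q'_max i).
  by rewrite (prob_eq_pairVWsame hQ') /gap /mismatch_at; lra.
exists Q; split=> // i; apply/(maximal_couplingE hP); split; first exact: pairVWsame_coupling.
rewrite (prob_eq_pairVWsame Q_coup); congr (1 - _).
(* The total mismatch of [Q] is now at most the sum of the minimal values gap/2, so every connection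
   attains its minimum. *)
rewrite max_l in Q_le; last by lra.
apply/le_anti; rewrite (mismatch_at_ge hP Q_coup) andbT.
move: Q_le; rewrite /mismatch /d (bigD1 i) //= [in X in _ * X](bigD1 i) //=.
have : 2^-1 * \sum_(j < 5 | j != i) gap P j <= \sum_(j < 5 | j != i) mismatch_at Q j.
  by rewrite mulr_sumr; apply: ler_sum => j _; rewrite mulrC mismatch_at_ge.
by rewrite /mismatch_at /gap; lra.
Qed.
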